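(* Let $X$ be a $d$-dimensional random vector with non-degenerate components and define $Z(t)=(t,X)-\kappa(t)$, $t\in\mathbb R^d$, where $\kappa$ is some measurable function satisfying $\kappa(0)=0$. Suppose that the associated max-stable process $\zeta_Z(t),t\in\mathbb R^d$ has unit Gumbel marginals. If for any $\delta\in(0,\infty)$ and any $h\in\delta\mathbb Z^d$ $$\Xi_hZ(t)\overset{fdd}{=}L^hZ(t),\qquad t\in\delta\mathbb Z^d,$$ then $X$ is Gaussian $N_d(\mu,\Sigma)$ and $\kappa(t)=(t,\mu)+(t,\Sigma t)/2$, $t\in\mathbb R^d$.
   Context: $(\cdot,\cdot)$ is the scalar product in $\mathbb R^d$. $\overset{fdd}{=}$ means equality of all finite dimensional distributions (here for indices $t\in\delta\mathbb Z^d$). $L^hZ(t)=Z(t-h)$. Associated max-stable process: $\zeta_Z(t)=\max_{i\ge1}(P_i+Z_i(t))$, where $\sum_i\varepsilon_{P_i}$ is a Poisson point process on $\mathbb R$ with intensity $e^{-x}dx$ and $Z_i$ are independent copies of $Z$, independent of the point process. Unit Gumbel marginals ($\mathbb P\{\zeta_Z(t)\le x\}=e^{-e^{-x}}$) means $\mathbb E\{e^{Z(t)}\}=1$ for all $t$. The tilt $Z^{[h]}$ of $Z$ by $Z(h)$ has law $\mathbb P\{Z^{[h]}\in A\}=\mathbb E\{e^{Z(h)}\mathbb I\{Z\in A\}\}$ for $A$ in the $\sigma$-field generated by evaluation maps, and $\Xi_hZ(t)=Z^{[h]}(t)-Z^{[h]}(h)$. *)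

(* Defs.v *)
(* MathComp / MathComp-Analysis *)
From HB Require Import structures.
From mathcomp Require Import all_boot all_order all_algebra.
From mathcomp Require Import all_classical all_reals all_analysis.
Set Implicit Arguments.
Unset Strict Implicit.
Unset Printing Implicit Defensive.
Import Order.TTheory GRing.Theory Num.Theory.
Local Open Scope classical_set_scope.
Local Open Scope ring_scope.

Section euclidean.
Context {R : realType} {n : nat}.

Definition dotv (u v : 'cV[R]_n) : R := \sum_i u i 0 * v i 0.

Definition lattice (delta : R) : set 'cV[R]_n :=
  [set t | exists z : 'cV[int]_n, t = delta *: map_mx intr z].

(* The Borel sigma-algebra of R^n is the product one carried by n.-tuple R. *)
Definition borel_measurable (f : 'cV[R]_n -> R) : Prop :=
  measurable_fun [set: n.-tuple R] (fun x : n.-tuple R => f (\col_i tnth x i)).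

Definition translate {T : Type} (h : 'cV[R]_n) (Y : 'cV[R]_n -> T -> R) :
  'cV[R]_n -> T -> R := fun t => Y (t - h).

End euclidean.

Section laws.
Context {R : realType} {I : Type}.

(* A (law of a) process on the index set I is represented by the set function
   A |-> P{path in A} on sets of paths; only its values on finite-dimensional
   cylinders are compared. *)
Definition path_law {disp} {T : measurableType disp} (P : probability T R)
    (Y : I -> T -> R) (A : set (I -> R)) : \bar R :=
  P [set w | A (Y ^~ w)].

Definition fdd_eq (D : set I) (L1 L2 : set (I -> R) -> \bar R) : Prop :=
  forall (k : nat) (t : 'I_k -> I) (B : set (k.-tuple R)),
    (forall i, D (t i)) -> measurable B ->
    L1 [set f | B [tuple f (t i) | i < k]] =
    L2 [set f | B [tuple f (t i) | i < k]].

(* Law of Y^[h]: A |-> E[exp (Y h) ; Y in A]. *)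
Definition tilt_law {disp} {T : measurableType disp} (P : probability T R)
    (Y : I -> T -> R) (h : I) (A : set (I -> R)) : \bar R :=
  'E_P[fun w => expR (Y h w) * \1_A (Y ^~ w)].

(* Law of Xi_h Y = Y^[h] - Y^[h](h). *)
Definition Xi_law {disp} {T : measurableType disp} (P : probability T R)
    (Y : I -> T -> R) (h : I) (A : set (I -> R)) : \bar R :=
  tilt_law P Y h [set f | A (fun t => f t - f h)].

End laws.

Section independence.
Context {R : realType} {disp} {T : measurableType disp} (Q : probability T R).

Definition sigma_of {J : Type} (Y : J -> T -> R) : set (set T) :=
  <<s [set A | exists j (B : set R), measurable B /\ A = Y j @^-1` B] >>.

Definition mutually_independent {J : choiceType} (G : J -> set (set T)) : Prop :=
  forall (s : seq J) (A : J -> set T), uniq s ->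
    (forall j, j \in s -> G j (A j)) ->
    Q (\big[setI/setT]_(j <- s) A j) = (\prod_(j <- s) Q (A j))%E.

End independence.

Section max_stable.
Context {R : realType} {disp} {T : measurableType disp} (Q : probability T R).

(* number of points of the point process sum_i eps_(pt i) lying in A *)
Definition point_count (pt : nat -> T -> R) (A : set R) (w : T) : \bar R :=
  (\sum_(0 <= i <oo) (\1_A (pt i w))%:E)%E.

Definition exp_intensity (A : set R) : \bar R :=
  (\int[lebesgue_measure]_(x in A) (expR (- x))%:E)%E.

(* Unlike the library's poisson_pmf, this also covers the rate 0, where it is
   the point mass at 0; it is needed for sets of intensity 0. *)
Definition poisson_weight (rate : R) (k : nat) : R :=
  rate ^+ k / k`!%:R * expR (- rate).

(* Counts over pairwise disjoint Borel sets of finite intensity are independent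
   Poisson variables with the prescribed means. *)
Definition exp_poisson_process (pt : nat -> T -> R) : Prop :=
  forall (n : nat) (A : 'I_n -> set R) (k : 'I_n -> nat),
    (forall j, measurable (A j)) ->
    (forall j, (exp_intensity (A j) < +oo)%E) ->
    trivIset setT A ->
    Q [set w | forall j, point_count pt (A j) w = ((k j)%:R)%:E] =
    (\prod_(j < n) poisson_weight (fine (exp_intensity (A j))) (k j))%:E.

Context {I : Type}.

(* (pt, Zc) realizes the spectral representation attached to Z: the points form
   a Poisson process with intensity exp(-x)dx, every Zc i is a copy of Z, and
   the points and the copies are independent.  The index None stands for the
   sequence of points. *)
Definition max_stable_representation {disp0} {T0 : measurableType disp0}
    (P : probability T0 R) (Z : I -> T0 -> R)
    (pt : nat -> T -> R) (Zc : nat -> I -> T -> R) : Prop :=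
  [/\ exp_poisson_process pt,
      forall i, fdd_eq setT (path_law Q (Zc i)) (path_law P Z) &
      mutually_independent Q (fun j : option nat =>
        if j is Some i then sigma_of (Zc i) else sigma_of pt)].

Definition zeta (pt : nat -> T -> R) (Zc : nat -> I -> T -> R)
    (t : I) (w : T) : \bar R :=
  ereal_sup (range (fun i => (pt i w + Zc i t w)%:E)).

Definition unit_gumbel_marginals (Y : I -> T -> \bar R) : Prop :=
  forall (t : I) (x : R),
    Q [set w | (Y t w <= x%:E)%E] = (expR (- expR (- x)))%:E.

End max_stable.

Section random_vector.
Context {R : realType} {disp} {T : measurableType disp} (P : probability T R).

Definition rvec {n : nat} (X : 'I_n -> T -> R) (w : T) : 'cV[R]_n :=
  \col_i X i w.

Definition degenerate (Y : T -> R) : Prop :=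
  exists c : R, P [set w | Y w = c] = 1%E.

(* The library's normal_prob takes the standard deviation and is not a point
   mass at standard deviation 0. *)
Definition normal_law (m v : R) (B : set R) : \bar R :=
  if v == 0 then \d_m B else normal_prob m (Num.sqrt v) B.

(* N_n(mu, Sigma), with Sigma possibly singular: every linear functional
   (t, X) is N((t, mu), (t, Sigma t)). *)
Definition gaussian_vector {n : nat} (X : 'I_n -> T -> R)
    (mu : 'cV[R]_n) (Sigma : 'M[R]_n) : Prop :=
  [/\ Sigma^T = Sigma,
      forall t, 0 <= dotv t (Sigma *m t) &
      forall (t : 'cV[R]_n) (B : set R), measurable B ->
        P [set w | B (dotv t (rvec X w))] =
        normal_law (dotv t mu) (dotv t (Sigma *m t)) B].

Definition linear_process {n : nat} (X : 'I_n -> T -> R) (kappa : 'cV[R]_n -> R)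
    (t : 'cV[R]_n) (w : T) : R :=
  dotv t (rvec X w) - kappa t.

End random_vector.

(* Main.v *)
Require Import Defs.
From HB Require Import structures.
From mathcomp Require Import all_boot all_order all_algebra.
From mathcomp Require Import all_classical all_reals all_analysis.
From mathcomp Require Import measurable_realfun.
From mathcomp Require Import ring lra.

(** The argument works with the tilts of the law of X by exp (h, X).

    Let h = a e_i be a point of a coordinate axis.  The lattice of mesh |a|
    contains h and all the points h + |a| e_j, and the increments of Z from h
    to these points determine X.  The hypothesis on the tilted process
    therefore says that the tilt of the law of X by exp (h, X) is a translate
    of that law, with normalization exp (kappa h).  Tilts compose, and so do
    translations; every vector is a sum of vectors on the axes, so the tilt in
    any direction h, not only in the directions of lattice points, translates
    the law of X by some w(h), with normalization exp (k(h)).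

    Comparing Laplace transforms, k (h + s) = k h + k s + (s, w h).  The
    left-hand side is symmetric, so w is a symmetric linear map Sigma, and
    k h - (h, Sigma h) / 2 is additive.  Jensen's inequality bounds k below by
    the linear form (h, mu), mu being the mean of X; this forces
    k h = (h, mu) + (h, Sigma h) / 2 ([quadratic_of_cocycle]).

    Now fix t and put Y = (t, X), with m = (t, mu) and v = (t, Sigma t).
    Weighting the law of Y by exp (b y) shifts it by b v, for every real b.
    Integrating this relation over b, with Tonelli's theorem and the translation
    invariance of Lebesgue measure, yields the density of Y, which is that of
    N(m, v) ([normal_law_of_tilt]).  So X is N(mu, Sigma) and kappa = k on the
    axes.

    The lattice hypothesis does not see kappa t when the coordinates of t are
    incommensurable; the Gumbel marginals do.  Choose t' on the first axis with
    (t', Sigma t') = (t, Sigma t).  Then (t, X) - (t, mu) and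
    (t', X) - (t', mu) have the same law, hence so do the maxima of
    P_i + Z_i(t) + kappa t - (t, mu) and P_i + Z_i(t') + kappa t' - (t', mu).
    Both are Gumbel variables up to a constant, so
    kappa t - (t, mu) = kappa t' - (t', mu) = (t, Sigma t) / 2
    ([eq_gumbel_location]). *)

Set Implicit Arguments.
Unset Strict Implicit.
Unset Printing Implicit Defensive.
Import Order.TTheory GRing.Theory Num.Theory.
Local Open Scope classical_set_scope.
Local Open Scope ring_scope.

(** * Integrals and laws *)

Lemma measurable_preimageT d d' (T : measurableType d) (S : measurableType d')
    (f : T -> S) (B : set S) :
  measurable_fun setT f -> measurable B -> measurable (f @^-1` B).
Proof. by move=> mf mB; rewrite -[X in measurable X]setTI; exact: mf. Qed.

Lemma integral_probability_cst d (T : measurableType d) (R : realType)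
    (P : probability T R) (c : \bar R) : (\int[P]_w c = c)%E.
Proof.
by rewrite integral_cst// [X in (_ * X)%E](@probability_setT _ _ _ P) mule1.
Qed.

Lemma integral_indic_comp d d' (T : measurableType d) (S : measurableType d')
    (R : realType) (m : {measure set T -> \bar R}) (Y : T -> S) (B : set S) :
  measurable_fun setT Y -> measurable B ->
  (\int[m]_w (\1_B (Y w))%:E = m (Y @^-1` B))%E.
Proof.
move=> mY mB; rewrite -[in RHS](setIT (Y @^-1` B)) -integral_indic//.
exact: measurable_preimageT.
Qed.

Section weighted_laws.
Local Open Scope ereal_scope.
Context d1 d2 d3 (T1 : measurableType d1) (T2 : measurableType d2)
  (S : measurableType d3) (R : realType).
Variables (m1 : {measure set T1 -> \bar R}) (m2 : {measure set T2 -> \bar R}).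
Variables (g1 : T1 -> R) (g2 : T2 -> R) (Y1 : T1 -> S) (Y2 : T2 -> S).
Hypotheses (g1_ge0 : forall x, (0 <= g1 x)%R) (g2_ge0 : forall x, (0 <= g2 x)%R).
Hypotheses (mg1 : measurable_fun setT g1) (mg2 : measurable_fun setT g2).
Hypotheses (mY1 : measurable_fun setT Y1) (mY2 : measurable_fun setT Y2).

Import HBNNSimple.

Let integral_weighted_nnsfun d (T : measurableType d)
    (m : {measure set T -> \bar R}) (g : T -> R) (Y : T -> S)
    (f : {nnsfun S >-> R}) :
  (forall x, (0 <= g x)%R) -> measurable_fun setT g -> measurable_fun setT Y ->
  \int[m]_x ((g x)%:E * (f (Y x))%:E) =
  \sum_(r \in range f) (r%:E * \int[m]_x (g x * \1_(f @^-1` [set r]) (Y x))%:E).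
Proof.
move=> g0 mg mY.
have mi r : measurable_fun [set: T]
    (EFin \o (fun x => (g x * \1_(f @^-1` [set r]) (Y x))%R)).
  apply/measurable_EFinP; apply: measurable_funM => //.
  by apply: measurableT_comp => //; exact: measurable_indic.
transitivity (\int[m]_x \sum_(r \in range f)
    (r * (g x * \1_(f @^-1` [set r]) (Y x)))%:E).
  apply: eq_integral => x _; rewrite -EFinM fsumEFin; last exact: fimfunP.
  rewrite {1}(fimfunE f (Y x)) mulr_fsumr; congr EFin; apply: eq_fsbigr => r _.
  by rewrite mulrCA.
rewrite ge0_integral_fsum//; last 2 first.
- move=> r; apply/measurable_EFinP; apply: measurable_funM => //.
  by apply/measurable_EFinP; exact: mi.
- move=> r x _; rewrite lee_fin mulrCA mulr_ge0//.
  by have := nnfun_muleindic_ge0 f r (Y x); rewrite -EFinM lee_fin.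
apply: eq_fsbigr => r _.
have [r0|r0] := ltP r 0%R.
  rewrite preimage_nnfun0//.
  by rewrite !integral0_eq ?mule0// => x _; rewrite indic0 mulr0 ?mulr0.
rewrite -ge0_integralZl_EFin//.
- by move=> x _; rewrite lee_fin mulr_ge0.
- exact: mi.
Qed.

(** An identity between weighted laws, given on sets, passes to functions by
    approximation with simple functions and monotone convergence. *)
Lemma eq_weighted_law :
  (forall B, measurable B -> \int[m1]_x (g1 x * \1_B (Y1 x))%:E =
                             \int[m2]_x (g2 x * \1_B (Y2 x))%:E) ->
  forall f : S -> \bar R, measurable_fun setT f -> (forall s, 0 <= f s) ->
  \int[m1]_x ((g1 x)%:E * f (Y1 x)) = \int[m2]_x ((g2 x)%:E * f (Y2 x)).
Proof.
move=> eqB f mf f0.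
pose f_ := nnsfun_approx measurableT mf.
have cvgT d (T : measurableType d) (m : {measure set T -> \bar R}) (g : T -> R)
    (Y : T -> S) : (forall x, (0 <= g x)%R) -> measurable_fun setT g ->
    measurable_fun setT Y ->
    \int[m]_x ((g x)%:E * (f_ n (Y x))%:E) @[n --> \oo] -->
    \int[m]_x ((g x)%:E * f (Y x)).
  move=> g0 mg mY.
  rewrite [X in _ --> X](_ : _ =
      \int[m]_x limn (fun n => (g x)%:E * (f_ n (Y x))%:E)); last first.
    apply: eq_integral => x _; apply/esym/cvg_lim => //.
    by apply: cvgeZl => //; exact: cvg_nnsfun_approx.
  apply: cvg_monotone_convergence => //.
  - move=> n; apply: emeasurable_funM; apply/measurable_EFinP => //.
    by apply: measurableT_comp.
  - by move=> n x _; rewrite mule_ge0// lee_fin.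
  - move=> x _ i j ij; apply: lee_pmul => //; rewrite ?lee_fin//.
    exact/lefP/nd_nnsfun_approx.
have lim1 := cvgT _ _ m1 _ _ g1_ge0 mg1 mY1.
have lim2 := cvgT _ _ m2 _ _ g2_ge0 mg2 mY2.
rewrite -(cvg_lim (@ereal_hausdorff R) lim1) -(cvg_lim (@ereal_hausdorff R) lim2).
congr (lim (_ @ \oo)); apply/funext => n.
rewrite !integral_weighted_nnsfun//; apply: eq_fsbigr => r _.
by rewrite eqB.
Qed.

End weighted_laws.

Lemma ge0_integral_translation (R : realType) (c : R) (f : R -> \bar R) :
  measurable_fun setT f -> (forall x, 0 <= f x)%E ->
  (\int[lebesgue_measure]_x f ((x : R) + c)%R = \int[lebesgue_measure]_x f x)%E.
Proof.
move=> mf f0.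
pose tr : measurableTypeR R -> measurableTypeR R := +%R^~ c.
have mtr : measurable_fun setT tr by apply: measurable_funD.
rewrite -[LHS](@ge0_integral_pushforward _ _ _ _ _ tr mtr lebesgue_measure setT f)//.
apply: eq_measure_integral => A mA _; apply/esym.
apply: (@lebesgue_measure_unique _ (pushforward lebesgue_measure tr)) => //.
move=> _ [[a b]] _ <-.
rewrite /pushforward [X in _ = lebesgue_measure X](_ : _ = `]a - c, b - c]%classic).
  rewrite !lebesgue_measure_itv/= !lte_fin ltrD2r.
  by case: ifPn => // _; rewrite -!EFinD opprB addrA subrK.
by apply/seteqP; split=> x; rewrite /tr /preimage /= !in_itv/= ltrBlDr lerBrDr.
Qed.

Lemma integrable_expR d (T : measurableType d) (R : realType)
    (P : probability T R) (Y : T -> R) (c : R) :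
  measurable_fun setT Y -> (\int[P]_w (expR (Y w))%:E = c%:E)%E ->
  P.-integrable setT (EFin \o (fun w => expR (Y w))).
Proof.
move=> mY eY; apply/integrableP; split.
  by apply/measurable_EFinP; exact: measurableT_comp.
under eq_integral do rewrite /= ger0_norm ?expR_ge0//.
by rewrite eY ltry.
Qed.

(** Because |y| <= exp y + exp (- y). *)
Lemma integrable_of_laplace d (T : measurableType d) (R : realType)
    (P : probability T R) (Y : T -> R) (k1 k2 : R) :
  measurable_fun setT Y ->
  (\int[P]_w (expR (Y w))%:E = k1%:E)%E ->
  (\int[P]_w (expR (- Y w))%:E = k2%:E)%E ->
  P.-integrable setT (EFin \o Y).
Proof.
move=> mY e1 e2.
have ie1 := integrable_expR mY e1.
have mNY : measurable_fun setT (fun w => - Y w) by exact: measurableT_comp.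
have ie2 := integrable_expR mNY e2.
apply: (le_integrable measurableT _ _ (integrableD measurableT ie1 ie2)).
  exact/measurable_EFinP.
move=> w _; rewrite lee_fin.
rewrite [leRHS]ger0_norm ?addr_ge0 ?expR_ge0//.
rewrite ler_norml; have := expR_ge1Dx (Y w); have := expR_ge1Dx (- Y w).
by have := expR_gt0 (Y w); have := expR_gt0 (- Y w); lra.
Qed.

(** Jensen's inequality for exp, from its tangent 1 + x <= exp x at x = Y - k. *)
Lemma mean_le_log_laplace d (T : measurableType d) (R : realType)
    (P : probability T R) (Y : T -> R) (k : R) :
  P.-integrable setT (EFin \o Y) ->
  (\int[P]_w (expR (Y w))%:E = (expR k)%:E)%E ->
  (\int[P]_w (Y w)%:E <= k%:E)%E.
Proof.
move=> iY eY.
have mY : measurable_fun setT Y by exact/measurable_EFinP/(measurable_int _ iY).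
have ie := integrable_expR mY eY.
have iz : P.-integrable setT (EFin \o (fun w => expR (- k) * expR (Y w))).
  exact: (integrableZl _ _ ie).
have ic : P.-integrable setT (EFin \o cst (k - 1)) by exact: finite_measure_integrable_cst.
have -> : k%:E = (\int[P]_w (expR (- k) * expR (Y w))%:E + \int[P]_w (k - 1)%:E)%E.
  under eq_integral do rewrite EFinM.
  rewrite integralZl// eY -EFinM -expRD addNr expR0 integral_probability_cst.
  by rewrite -EFinD addrC subrK.
rewrite -integralD//; apply: le_integral => //; first exact: integrableD.
move=> w _; rewrite -EFinD lee_fin -expRD.
by have := expR_ge1Dx (- k + Y w); lra.
Qed.

(** * Normal laws *)

Section normal_law_of_tilt.
Local Open Scope ereal_scope.
Context d (T : measurableType d) (R : realType) (P : probability T R).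
Variables (Y : T -> R) (m v : R).
Hypotheses (mY : measurable_fun setT Y) (v_ge0 : (0 <= v)%R).
Hypothesis tiltY : forall (b : R) (f : R -> \bar R),
  measurable_fun setT f -> (forall y, 0 <= f y) ->
  \int[P]_w ((expR (b * Y w))%:E * f (Y w)) =
  (expR (b * m + b ^+ 2 * v / 2))%:E * \int[P]_w f (Y w + b * v)%R.

(** As a function of b, the weight of the tilt with parameter b / v becomes a
    normal density centered at y - m, of total mass 1, once it is multiplied by
    the density of N(m, v) at y. *)
Lemma tilted_normal_pdf (b y : R) : (0 < v)%R ->
  (expR (b / v * y) * normal_pdf m (Num.sqrt v) y =
   expR (b / v * m + (b / v) ^+ 2 * v / 2) *
   normal_pdf 0 (Num.sqrt v) (b - (y - m)))%R.
Proof.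
move=> v0; have s0 : Num.sqrt v != 0%R by rewrite gt_eqF// sqrtr_gt0.
rewrite !normal_pdfE//= /normal_fun !sqr_sqrtr ?ltW//.
rewrite mulrCA [RHS]mulrCA -!expRD; congr (_ * expR _)%R.
by field; rewrite gt_eqF.
Qed.

Let measurable_side (b : R) : measurable [set y : R | (0 < b * (y - m))%R].
Proof.
rewrite (_ : mkset _ = (fun y => b * (y - m))%R @^-1` `]0%R, +oo[%classic).
  apply: measurable_preimageT => //.
  by apply: measurable_funM => //; exact: measurable_funB.
by apply/seteqP; split=> y /=; rewrite in_itv/= andbT.
Qed.

(** F and G below are the two sides of the tilt relation at b / v, for f the
    density of N(m, v) restricted to B, without the constant that they share.
    Integrating over b first, F gives the law of Y, and G gives the integral of
    f by translation invariance. *)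
Let tilt_law_gt0 : (0 < v)%R -> forall B, measurable B ->
  P (Y @^-1` B) = normal_prob m (Num.sqrt v) B.
Proof.
move=> v0 B mB; set s := Num.sqrt v.
pose f (y : R) : \bar R := (normal_pdf m s y * \1_B y)%:E.
have mf : measurable_fun [set: R] f.
  apply/measurable_EFinP; apply: measurable_funM; last exact: measurable_indic.
  exact: measurable_normal_pdf.
have f0 y : 0 <= f y by rewrite lee_fin mulr_ge0 ?normal_pdf_ge0.
pose F (x : measurableTypeR R * T) : \bar R :=
  (normal_pdf 0 s ((x.1 : R) - (Y x.2 - m)) * \1_B (Y x.2))%:E.
have mF : measurable_fun setT F.
  apply/measurable_EFinP; apply: measurable_funM.
    apply: measurableT_comp; first exact: measurable_normal_pdf.
    apply: measurable_funB => //.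
    by apply: measurable_funB => //; exact: measurableT_comp.
  apply: measurableT_comp; first exact: measurable_indic.
  exact: measurableT_comp.
have F0 x : 0 <= F x by rewrite lee_fin mulr_ge0 ?normal_pdf_ge0.
pose G (x : measurableTypeR R * T) : \bar R := f (Y x.2 + (x.1 : R))%R.
have mG : measurable_fun setT G.
  apply: measurableT_comp => //; apply: measurable_funD => //.
  exact: measurableT_comp.
transitivity (\int[P]_w \int[lebesgue_measure]_b F (b, w)).
  rewrite -integral_indic_comp//; apply: eq_integral => w _; rewrite /F/=.
  under eq_integral do rewrite EFinM muleC.
  rewrite ge0_integralZl_EFin//.
  - under eq_integral do rewrite -[(_ - _)%R]/(_ + - (Y w - m))%R.
    rewrite (@ge0_integral_translation _ _ (fun x => (normal_pdf 0 s x)%:E)).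
    + by rewrite integral_normal_pdf mule1.
    + by apply/measurable_EFinP; exact: measurable_normal_pdf.
    + by move=> x; rewrite lee_fin normal_pdf_ge0.
  - by move=> x _; rewrite lee_fin normal_pdf_ge0.
  - apply/measurable_EFinP; apply: measurableT_comp.
      exact: measurable_normal_pdf.
    exact: measurable_funB.
rewrite -(fubini_tonelli F mF F0).
transitivity (\int[lebesgue_measure]_b \int[P]_w G (b, w)).
  apply: eq_integral => b _.
  set c : R := expR ((b : R) / v * m + ((b : R) / v) ^+ 2 * v / 2).
  have c0 : (0 < c)%R by exact: expR_gt0.
  have := tiltY ((b : R) / v) mf f0; rewrite -/c divfK ?gt_eqF// => tiltf.
  have {}tiltf : \int[P]_w (c%:E * F (b, w)) = c%:E * \int[P]_w G (b, w).
    rewrite -[RHS]tiltf; apply: eq_integral => w _.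
    rewrite /F /f/= -!EFinM [in RHS]mulrA mulrA; congr (_ * _)%:E.
    exact/esym/(tilted_normal_pdf (b : R) (Y w) v0).
  move: tiltf; rewrite ge0_integralZl_EFin ?ltW//; last first.
    by apply: measurableT_comp mF _; exact: measurable_pair1.
  move=> /(congr1 (fun x => (c^-1)%:E * x)).
  by rewrite !muleA -!EFinM mulVf ?gt_eqF// !mul1e.
rewrite (fubini_tonelli G mG (fun x => f0 _)).
transitivity (\int[P]_w \int[lebesgue_measure]_b f b).
  apply: eq_integral => w _.
  rewrite -(ge0_integral_translation (Y w) mf f0).
  by apply: eq_integral => b _; rewrite /G addrC.
rewrite integral_probability_cst.
rewrite /normal_prob [RHS]integral_mkcond; apply: eq_integral => y _.
by rewrite /f restrict_EFin/= patch_indic.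
Qed.

(** When v = 0 the normalized tilt by exp (b (Y - m)) preserves the law of Y,
    although it increases the weight of every point where b (Y - m) > 0; so
    these points have no mass. *)
Let tilt_law_eq0 : v = 0%R -> forall b : R,
  P [set w | (0 < b * (Y w - m))%R] = 0.
Proof.
move=> v0 b; pose A := [set y : R | (0 < b * (y - m))%R].
have mA : measurable A := measurable_side b.
have mYA : measurable (Y @^-1` A) by exact: measurable_preimageT.
pose e w : \bar R := ((expR (b * (Y w - m)) - 1) * \1_A (Y w))%:E.
have e0 w : 0 <= e w.
  rewrite lee_fin indicE; have [|] := boolP (Y w \in A) => YA; last by rewrite mulr0.
  by rewrite mulr1 subr_ge0 -[leLHS]expR0 ler_expR ltW//; move: YA; rewrite inE.
have me : measurable_fun setT e.
  apply/measurable_EFinP; apply: measurable_funM.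
    apply: measurable_funB => //; apply: measurableT_comp => //.
    by apply: measurable_funM => //; exact: measurable_funB.
  by apply: measurableT_comp => //; exact: measurable_indic.
have mIA : measurable_fun setT (fun w => (\1_A (Y w))%:E : \bar R).
  by apply/measurable_EFinP; apply: measurableT_comp => //; exact: measurable_indic.
have : P (Y @^-1` A) + \int[P]_w e w = P (Y @^-1` A) + 0.
  rewrite adde0 -[in LHS]integral_indic_comp// -ge0_integralD//.
  pose f (y : R) : \bar R := (expR (- (b * m)) * \1_A y)%:E.
  have mf : measurable_fun [set: R] f.
    by apply/measurable_EFinP; apply: measurable_funM => //; exact: measurable_indic.
  have f0 y : 0 <= f y by rewrite lee_fin mulr_ge0// expR_ge0.
  have := tiltY b mf f0; rewrite v0 !mulr0 mul0r addr0.
  under [in RHS]eq_integral do rewrite addr0 /f EFinM.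
  rewrite ge0_integralZl_EFin ?expR_ge0//.
  rewrite integral_indic_comp// muleA -EFinM -expRD subrr expR0 mul1e => <-.
  apply: eq_integral => w _; rewrite /f /e -EFinM -EFinD; congr EFin.
  by rewrite mulrA -expRD mulrBl mul1r addrC subrK mulrBr.
have Pfin : P (Y @^-1` A) \is a fin_num by rewrite fin_num_measure.
move/(congr1 (fun x => x - P (Y @^-1` A))); rewrite adde0 subee// addeAC subee// add0e => Ie0.
have /(ae_eq_integral_abs P measurableT me) ae0 : \int[P]_w `|e w| = 0.
  by rewrite -Ie0; apply: eq_integral => w _; rewrite gee0_abs.
have : \int[P]_w (\1_A (Y w))%:E = \int[P]_w cst 0 w.
  apply: ge0_ae_eq_integral => //; apply: filterS ae0 => w /(_ I) + _.
  rewrite /e/= indicE; case: (boolP (Y w \in A)) => [YA|//] /=.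
  rewrite mulr1 => -[] /eqP; rewrite subr_eq0 -[X in _ == X]expR0.
  move: YA; rewrite inE /A/= => Yb /eqP/expR_inj e0'.
  by rewrite e0' ltxx in Yb.
by rewrite integral_indic_comp// integral0.
Qed.

(** Multiplying the law of Y by exp (b y) shifts it by b v up to a constant, for
    every b: integrating over b averages the shifted laws into Lebesgue measure,
    and the weights into the reciprocal of a Gaussian density. *)
Lemma normal_law_of_tilt (B : set R) : measurable B ->
  P (Y @^-1` B) = normal_law m v B.
Proof.
move=> mB; rewrite /normal_law; case: eqVneq => [v0|vn0]; last first.
  by apply: tilt_law_gt0 => //; rewrite lt_neqAle eq_sym vn0.
have mA b : measurable [set w | (0 < b * (Y w - m))%R].
  exact: (measurable_preimageT mY (measurable_side b)).
pose N := [set w | (0 < 1 * (Y w - m))%R] `|` [set w | (0 < -1 * (Y w - m))%R].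
have mN : measurable N by exact: measurableU.
have N0 : P N = 0 by rewrite measureU0//; exact: tilt_law_eq0.
have YN w : Y w != m -> N w.
  rewrite /N/= mul1r mulN1r oppr_gt0 subr_gt0 subr_lt0 neq_lt => /orP.
  by case=> ?; [right|left].
have mYB : measurable (Y @^-1` B) by exact: measurable_preimageT.
rewrite diracE; case: (boolP (m \in B)); rewrite ?inE ?notin_setE => Bm.
  rewrite -[Y @^-1` B]setCK probability_setC; last exact: measurableC.
  rewrite (@subset_measure0 _ _ _ P (~` (Y @^-1` B)) N) ?sube0//; first exact: measurableC.
  by move=> w YB; apply: YN; apply/eqP => Ym; apply: YB; rewrite /= Ym.
apply: (@subset_measure0 _ _ _ P _ N) => // w YB.
by apply: YN; apply/eqP => Ym; apply: Bm; rewrite -Ym.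
Qed.

End normal_law_of_tilt.

(** The sign condition matters: for v < 0 the standard deviation is 0, where
    normal_pdf is by convention the uniform density on [0, 1] for every mean. *)
Lemma normal_law_centered (R : realType) (m v : R) (B : set R) :
  0 <= v -> measurable B ->
  normal_law m v [set y | B (y - m)] = normal_law 0 v B.
Proof.
move=> v_ge0 mB; rewrite /normal_law; case: eqVneq => [v0|vn0].
  by rewrite !diracE; congr (nat_of_bool _)%:R%:E; apply/idP/idP; rewrite !inE /= subrr.
set s := Num.sqrt v.
have s0 : s != 0 by rewrite gt_eqF// sqrtr_gt0 lt_neqAle eq_sym vn0.
pose f (y : R) : \bar R := (normal_pdf 0 s y * \1_B y)%:E.
have mf : measurable_fun [set: R] f.
  apply/measurable_EFinP; apply: measurable_funM; last exact: measurable_indic.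
  exact: measurable_normal_pdf.
have f0 y : (0 <= f y)%E by rewrite lee_fin mulr_ge0 ?normal_pdf_ge0.
rewrite /normal_prob [LHS]integral_mkcond [RHS]integral_mkcond.
transitivity (\int[lebesgue_measure]_y f ((y : R) - m)%R)%E.
  apply: eq_integral => y _; rewrite /f restrict_EFin/= patch_indic.
  by congr (_ * _)%:E; rewrite !normal_pdfE//= normal_fun_center.
rewrite (ge0_integral_translation (- m) mf f0).
by apply: eq_integral => y _; rewrite /f restrict_EFin/= patch_indic.
Qed.

(** * Quadratic functions *)

Section dot_product.
Context {R : realType} {n : nat}.
Implicit Types (u v : 'cV[R]_n) (a : R).

Lemma dotvC u v : dotv u v = dotv v u.
Proof. by apply: eq_bigr => i _; rewrite mulrC. Qed.

Lemma dotvDl u1 u2 v : dotv (u1 + u2) v = dotv u1 v + dotv u2 v.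
Proof. by rewrite -big_split; apply: eq_bigr => i _; rewrite mxE mulrDl. Qed.

Lemma dotvZl a u v : dotv (a *: u) v = a * dotv u v.
Proof. by rewrite mulr_sumr; apply: eq_bigr => i _; rewrite mxE mulrA. Qed.

Lemma dotvDr u v1 v2 : dotv u (v1 + v2) = dotv u v1 + dotv u v2.
Proof. by rewrite dotvC dotvDl !(dotvC u). Qed.

Lemma dotvZr a u v : dotv u (a *: v) = a * dotv u v.
Proof. by rewrite dotvC dotvZl dotvC. Qed.

Lemma dot0v u : dotv 0 u = 0.
Proof. by rewrite -(scale0r 0) dotvZl mul0r. Qed.

Lemma dotv_delta (i : 'I_n) u : dotv (delta_mx i 0) u = u i 0.
Proof.
rewrite /dotv (bigD1 i)//= mxE !eqxx mul1r big1 ?addr0// => j ji.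
by rewrite mxE (negbTE ji) mul0r.
Qed.

(** The left side of the cocycle identity is symmetric in h and s, so w is self-adjoint, hence
    linear.  What remains of k after subtracting the quadratic form is additive;
    as it exceeds a linear form minus a multiple of that quadratic form, which
    is negligible near 0, it is that linear form. *)
Lemma quadratic_of_cocycle (k : 'cV[R]_n -> R) (w : 'cV[R]_n -> 'cV[R]_n)
    (mu : 'cV[R]_n) :
  (forall h s, k (h + s) = k h + k s + dotv s (w h)) ->
  (forall h, dotv h mu <= k h) ->
  exists Sigma : 'M[R]_n, [/\ Sigma^T = Sigma,
    forall h, w h = Sigma *m h,
    forall h, 0 <= dotv h (Sigma *m h) &
    forall h, k h = dotv h mu + dotv h (Sigma *m h) / 2].
Proof.
move=> kD kmu.
have w_sym s h : dotv s (w h) = dotv h (w s).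
  by have := kD s h; rewrite addrC kD (addrC (k s)) => /addrI.
pose Sigma : 'M[R]_n := \matrix_(i, j) w (delta_mx j 0) i 0.
have wE h : w h = Sigma *m h.
  apply/matrixP => i j; rewrite (ord1 j) -dotv_delta w_sym !mxE.
  apply: eq_bigr => l _; rewrite mxE mulrC; congr (_ * _).
  by rewrite -!dotv_delta w_sym.
pose q h := dotv h (Sigma *m h) / 2.
pose A h := k h - q h - dotv h mu.
have AD h s : A (h + s) = A h + A s.
  rewrite /A /q kD mulmxDr !dotvDl !dotvDr -!wE (w_sym s h).
  by field.
have A0 : A 0 = 0 by apply: (addrI (A 0)); rewrite -AD !addr0.
have AN h : A (- h) = - A h by apply: (addrI (A h)); rewrite -AD !subrr.
have An m h : A (m%:R *: h) = m%:R * A h.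
  elim: m => [|m IH]; first by rewrite !scale0r mul0r.
  by rewrite -natr1 scalerDl mulrDl AD IH !scale1r mul1r.
(* A scales like h and q like h squared, so the next bound improves near 0. *)
have A_ge h : - q h <= A h by rewrite /A; have := kmu h; lra.
have qZ a h : q (a *: h) = a ^+ 2 * q h.
  by rewrite /q -scalemxAr dotvZl dotvZr; field.
have A_ge0 h : 0 <= A h.
  rewrite leNgt; apply/negP => Ah.
  have [m mP] : exists m : nat, q h < m.+1%:R * - A h.
    exists (Num.truncn (q h / - A h)); rewrite -ltr_pdivrMr ?oppr_gt0//.
    exact: truncnS_gt.
  have m0 : 0 < m.+1%:R :> R by rewrite ltr0n.
  have := A_ge (m.+1%:R^-1 *: h); rewrite qZ; set b := A (_ *: h) => qb.
  have Ab : A h = m.+1%:R * b by rewrite -An scalerA divff ?scale1r// gt_eqF.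
  move: mP; rewrite ltNge => /negP; apply.
  rewrite Ab mulrN mulrA -expr2 lerNl.
  apply: le_trans (ler_wpM2l (exprn_ge0 2 (ltW m0)) qb).
  by rewrite exprVn mulrN mulrA divff ?mul1r// expf_neq0// gt_eqF.
have {}A0 h : A h = 0.
  apply/eqP; rewrite eq_le A_ge0 andbT -oppr_ge0 -AN; exact: A_ge0.
have q_ge0 h : 0 <= q h by have := A_ge h; rewrite A0; lra.
exists Sigma; split.
- by apply/matrixP => i j; rewrite !mxE -!dotv_delta w_sym.
- exact: wE.
- by move=> h; have := q_ge0 h; rewrite /q; lra.
- by move=> h; have := A0 h; rewrite /A /q; lra.
Qed.

End dot_product.

(** * Exponential tilts of a random vector *)

Section exponential_tilts.
Local Open Scope ereal_scope.
Context d (T : measurableType d) (R : realType) (P : probability T R).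
Context {n : nat} (X : 'I_n -> T -> R).
Hypothesis mX : forall i, measurable_fun setT (X i).
Implicit Types (h s u : 'cV[R]_n) (k : R) (f : n.-tuple R -> \bar R).

Definition vector_at (w : T) : n.-tuple R := [tuple X i w | i < n].

Definition tuple_shift u (x : n.-tuple R) : n.-tuple R :=
  [tuple tnth x i + u i 0 | i < n]%R.

Definition tuple_dot h (x : n.-tuple R) : R := dotv h (\col_i tnth x i).

(** Testing against functions rather than sets lets f absorb another exponential
    weight, which is how tilts are composed. *)
Definition tilt_is_shift h k u := forall f,
  measurable_fun setT f -> (forall x, 0 <= f x) ->
  \int[P]_w ((expR (dotv h (rvec X w)))%:E * f (vector_at w)) =
  (expR k)%:E * \int[P]_w f (tuple_shift u (vector_at w)).

Lemma tuple_dot_vector_at h w : tuple_dot h (vector_at w) = dotv h (rvec X w).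
Proof.
by congr dotv; apply/matrixP => i j; rewrite !mxE tnth_mktuple.
Qed.

Lemma tuple_dot_shift h u x :
  tuple_dot h (tuple_shift u x) = (tuple_dot h x + dotv h u)%R.
Proof.
rewrite -dotvDr; congr dotv; apply/matrixP => i j.
by rewrite !mxE tnth_mktuple (ord1 j).
Qed.

Lemma measurable_vector_at : measurable_fun setT vector_at.
Proof.
apply/measurable_fun_tnthP => i; rewrite (_ : _ \o _ = X i)//.
by apply/funext => w /=; rewrite tnth_mktuple.
Qed.

Lemma measurable_tuple_shift u : measurable_fun setT (tuple_shift u).
Proof.
apply/measurable_fun_tnthP => i.
rewrite (_ : _ \o _ = fun x => tnth x i + u i 0)%R; last first.
  by apply/funext => w /=; rewrite tnth_mktuple.
by apply: measurable_funD => //; exact: measurable_tnth.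
Qed.

Lemma measurable_tuple_dot h : measurable_fun setT (tuple_dot h).
Proof.
apply: measurable_sum => i; apply: measurable_funM => //.
under eq_fun do rewrite mxE; exact: measurable_tnth.
Qed.

Lemma measurable_dot_rvec h : measurable_fun setT (fun w => dotv h (rvec X w)).
Proof.
rewrite (_ : (fun _ => _) = tuple_dot h \o vector_at).
  by apply: measurableT_comp; [exact: measurable_tuple_dot|exact: measurable_vector_at].
by apply/funext => w /=; rewrite tuple_dot_vector_at.
Qed.

Lemma tilt_is_shift0 : tilt_is_shift 0 0 0.
Proof.
move=> f mf f0; rewrite expR0 mul1e; apply: eq_integral => w _.
rewrite dot0v expR0 mul1e; congr f; apply: eq_from_tnth => i.
by rewrite !tnth_mktuple mxE addr0.
Qed.

(** Tilting by h1 + h2 is tilting by h1 and then by h2; the factor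
    exp (h2, u1) appears because the second weight sees the shifted vector. *)
Lemma tilt_is_shiftD h1 k1 u1 h2 k2 u2 :
  tilt_is_shift h1 k1 u1 -> tilt_is_shift h2 k2 u2 ->
  tilt_is_shift (h1 + h2) (k1 + k2 + dotv h2 u1)%R (u1 + u2).
Proof.
move=> S1 S2 f mf f0.
pose f2 x := (expR (tuple_dot h2 x))%:E * f x.
have mf2 : measurable_fun setT f2.
  apply: emeasurable_funM => //; apply/measurable_EFinP; apply: measurableT_comp => //.
  exact: measurable_tuple_dot.
have f20 x : 0 <= f2 x by rewrite mule_ge0// lee_fin expR_ge0.
transitivity (\int[P]_w ((expR (dotv h1 (rvec X w)))%:E * f2 (vector_at w))).
  apply: eq_integral => w _.
  by rewrite dotvDl expRD EFinM -muleA /f2 tuple_dot_vector_at.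
rewrite S1//.
pose f1 x := f (tuple_shift u1 x).
have mf1 : measurable_fun setT f1.
  by apply: measurableT_comp => //; exact: measurable_tuple_shift.
transitivity ((expR k1)%:E * ((expR (dotv h2 u1))%:E *
    \int[P]_w ((expR (dotv h2 (rvec X w)))%:E * f1 (vector_at w)))).
  congr (_ * _); rewrite -ge0_integralZl_EFin//.
  - apply: eq_integral => w _; rewrite /f2 tuple_dot_shift tuple_dot_vector_at.
    by rewrite addrC expRD EFinM muleA.
  - by move=> w _; apply: mule_ge0; rewrite ?lee_fin ?expR_ge0// /f1.
  - apply: emeasurable_funM; last first.
      by apply: measurableT_comp => //; exact: measurable_vector_at.
    apply/measurable_EFinP; apply: measurableT_comp => //.
    exact: measurable_dot_rvec.
rewrite S2 ?/f1// !muleA -!EFinM -!expRD; congr (_ * _).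
  by congr (expR _)%:E; rewrite addrAC.
apply: eq_integral => w _; congr f; apply: eq_from_tnth => i.
by rewrite !tnth_mktuple mxE -addrA (addrC (u2 i ord0)).
Qed.

(** The case f = exp (s, .), which the shift multiplies by exp (s, u). *)
Lemma laplace_shift h k u s : tilt_is_shift h k u ->
  \int[P]_w (expR (dotv (h + s) (rvec X w)))%:E =
  (expR (k + dotv s u))%:E * \int[P]_w (expR (dotv s (rvec X w)))%:E.
Proof.
move=> S; pose f x : \bar R := (expR (tuple_dot s x))%:E.
have mf : measurable_fun setT f.
  apply/measurable_EFinP; apply: measurableT_comp => //.
  exact: measurable_tuple_dot.
transitivity (\int[P]_w ((expR (dotv h (rvec X w)))%:E * f (vector_at w))).
  apply: eq_integral => w _.
  by rewrite /f -EFinM tuple_dot_vector_at -expRD -dotvDl.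
have f0 x : 0 <= f x by rewrite lee_fin expR_ge0.
rewrite (S f mf f0).
rewrite expRD EFinM -muleA -[in RHS]ge0_integralZl_EFin//.
- congr (_ * _); apply: eq_integral => w _.
  by rewrite /f tuple_dot_shift tuple_dot_vector_at addrC expRD EFinM.
- apply/measurable_EFinP; apply: measurableT_comp => //.
  exact: measurable_dot_rvec.
Qed.

Lemma laplace_tilt_is_shift h k u : tilt_is_shift h k u ->
  \int[P]_w (expR (dotv h (rvec X w)))%:E = (expR k)%:E.
Proof.
move=> /(laplace_shift 0); rewrite addr0 => ->; rewrite dot0v addr0.
under eq_integral do rewrite dot0v expR0.
by rewrite integral_probability_cst mule1.
Qed.

End exponential_tilts.

(** Shifts along the coordinate axes compose to a shift for every direction h;
    comparing Laplace transforms, the exponents satisfy the cocycle identity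
    and are quadratic.  Along the line spanned by t this gives the tilt relation
    of a normal law for (t, X). *)
Lemma gaussian_of_axis_tilts d (T : measurableType d) (R : realType)
    (P : probability T R) n (X : 'I_n -> T -> R) (kap : 'I_n -> R -> R) :
  (forall i, measurable_fun setT (X i)) ->
  (forall i a, exists u, tilt_is_shift P X (a *: delta_mx i 0) (kap i a) u) ->
  exists (mu : 'cV[R]_n) (Sigma : 'M[R]_n), gaussian_vector P X mu Sigma /\
    forall i a, let h := a *: delta_mx i 0 in
      kap i a = dotv h mu + dotv h (Sigma *m h) / 2.
Proof.
move=> mX axis.
have /choice[ku kuS] : forall h, exists ku, tilt_is_shift P X h ku.1 ku.2.
  move=> h; rewrite (matrix_sum_delta h).
  under eq_bigr do rewrite big_ord1.
  apply: (big_ind (fun h => exists ku, tilt_is_shift P X h ku.1 ku.2)).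
  - by exists (0, 0); exact: tilt_is_shift0.
  - move=> h1 h2 [[k1 u1] S1] [[k2 u2] S2].
    by exists (k1 + k2 + dotv h2 u1, u1 + u2); exact: tilt_is_shiftD.
  - by move=> i _; have [u S] := axis i (h i 0); exists (kap i (h i 0), u).
pose k h := (ku h).1; pose u h := (ku h).2.
have S h : tilt_is_shift P X h (k h) (u h) := kuS h.
have lap h : (\int[P]_w (expR (dotv h (rvec X w)))%:E = (expR (k h))%:E)%E.
  exact: (laplace_tilt_is_shift mX (S h)).
have lapE h k' u' : tilt_is_shift P X h k' u' -> k' = k h.
  by move=> /(laplace_tilt_is_shift mX); rewrite lap => -[e]; apply/esym; exact: expR_inj e.
have kD h s : k (h + s) = k h + k s + dotv s (u h).
  have := laplace_shift mX s (S h); rewrite !lap -EFinM -expRD => -[e].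
  by rewrite (expR_inj e) addrAC.
have iX i : P.-integrable setT (EFin \o X i).
  apply: (@integrable_of_laplace _ _ _ P _ (expR (k (delta_mx i 0)))
    (expR (k (- delta_mx i 0)))) => //.
    by rewrite -lap; apply: eq_integral => w _; rewrite dotv_delta mxE.
  rewrite -lap; apply: eq_integral => w _.
  by rewrite -[- delta_mx _ _]scaleN1r dotvZl mulN1r dotv_delta mxE.
pose mu : 'cV[R]_n := \col_i fine (\int[P]_w (X i w)%:E).
have intX h : P.-integrable setT (EFin \o (fun w => dotv h (rvec X w))) /\
    (\int[P]_w (dotv h (rvec X w))%:E = (dotv h mu)%:E)%E.
  have iZ i : P.-integrable setT (fun w => (h i 0)%:E * (X i w)%:E)%E.
    exact: (integrableZl _ _ (iX i)).
  have E w : (dotv h (rvec X w))%:E = (\sum_i (h i 0)%:E * (X i w)%:E)%E.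
    by rewrite /dotv -sumEFin; apply: eq_bigr => i _; rewrite mxE EFinM.
  split.
    rewrite (_ : EFin \o _ = fun w => \sum_i (h i 0)%:E * (X i w)%:E)%E.
      exact: (integrable_sum measurableT _ (fun i _ => iZ i)).
    by apply/funext => w; exact: E.
  under eq_integral do rewrite E.
  rewrite integral_sum// /dotv -sumEFin; apply: eq_bigr => i _.
  rewrite mxE EFinM fineK; first exact: (integralZl measurableT (iX i)).
  by apply: integrable_fin_num => //; exact: iX.
have k_ge h : dotv h mu <= k h.
  rewrite -lee_fin -(intX h).2; apply: mean_le_log_laplace; [exact: (intX h).1|].
  exact: lap.
have [Sigma [SigmaT uE Sigma_ge0 kE]] := quadratic_of_cocycle kD k_ge.
exists mu, Sigma; split; last by move=> i a h; have [v /lapE ->] := axis i a.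
split=> // t B mB.
apply: (@normal_law_of_tilt _ _ _ P (fun w => dotv t (rvec X w))) => //.
  exact: measurable_dot_rvec.
move=> b f mf f0.
have mft : measurable_fun setT (f \o tuple_dot t).
  by apply: measurableT_comp => //; exact: measurable_tuple_dot.
have := S (b *: t) _ mft (fun x => f0 _) => /=.
rewrite kE uE -!scalemxAr !dotvZl dotvZr => St.
transitivity (\int[P]_w ((expR (dotv (b *: t) (rvec X w)))%:E *
                        f (tuple_dot t (vector_at X w))))%E.
  by apply: eq_integral => w _; rewrite dotvZl tuple_dot_vector_at.
rewrite St; congr (_ * _)%E; first by congr (expR _)%:E; ring.
apply: eq_integral => w _.
by rewrite tuple_dot_shift tuple_dot_vector_at dotvZr.
Qed.

(** With delta = |a| the points h = a e_i and h + delta e_j lie in one lattice,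
    and the increments of the process over delta e_j carry the whole vector X. *)
Lemma axis_tilt_is_shift d (T : measurableType d) (R : realType)
    (P : probability T R) n (X : 'I_n -> {RV P >-> R}) (kappa : 'cV[R]_n -> R) :
  kappa 0 = 0 ->
  (forall delta : R, 0 < delta -> forall h : 'cV[R]_n, lattice delta h ->
     fdd_eq (lattice delta) (Xi_law P (linear_process X kappa) h)
       (path_law P (translate h (linear_process X kappa)))) ->
  forall i a, exists u,
    tilt_is_shift P X (a *: delta_mx i 0) (kappa (a *: delta_mx i 0)) u.
Proof.
move=> kappa0 hshift i a.
have [->|a0] := eqVneq a 0.
  by rewrite scale0r kappa0; exists 0; exact: tilt_is_shift0.
pose delta := `|a|; have delta0 : 0 < delta by rewrite normr_gt0.
pose h : 'cV[R]_n := a *: delta_mx i 0.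
pose e (j : 'I_n) : 'cV[R]_n := delta *: delta_mx j 0.
have eL j : lattice delta (e j).
  exists (delta_mx j 0); congr (_ *: _).
  by apply/matrixP => k l; rewrite !mxE; case: (_ && _).
have hL : lattice delta h.
  exists (sgz a *: delta_mx i 0); rewrite /h {1}(numEsg a) mulrC -scalerA.
  congr (_ *: _); apply/matrixP => k l.
  by rewrite !mxE rmorphM/= -sgrEz; case: (_ && _).
have LD (s t : 'cV[R]_n) : lattice delta s -> lattice delta t -> lattice delta (s + t).
  move=> [x ->] [y ->]; exists (x + y); rewrite -scalerDr; congr (_ *: _).
  by apply/matrixP => k l; rewrite !mxE rmorphD.
pose t j := h + e j.
(* the drift that the tilt adds to X j *)
pose u : 'cV[R]_n := \col_j ((kappa (t j) - kappa h - kappa (e j)) / delta).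
have mX j : measurable_fun setT (X j) by [].
have mV := measurable_vector_at mX.
exists u => f mf f0; rewrite -/h.
pose Z := linear_process X kappa.
have key (B0 : set (n.-tuple R)) : measurable B0 ->
    (\int[P]_w (expR (dotv h (rvec X w)) * \1_B0 (vector_at X w))%:E =
     \int[P]_w (expR (kappa h) * \1_B0 (tuple_shift u (vector_at X w)))%:E)%E.
  move=> mB0.
  (* resc recovers X from the increments of Z; B0 is arbitrary, so the relation
     is applied to its preimage by resc. *)
  pose resc (y : n.-tuple R) : n.-tuple R :=
    [tuple (tnth y j + kappa (t j) - kappa h) / delta | j < n].
  have mresc : measurable_fun setT resc.
    apply/measurable_fun_tnthP => j.
    rewrite (_ : _ \o _ = fun y => (tnth y j + kappa (t j) - kappa h) / delta).
      apply: measurable_funM => //; apply: measurable_funB => //.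
      by apply: measurable_funD => //; exact: measurable_tnth.
    by apply/funext => w /=; rewrite tnth_mktuple.
  have mB : measurable (resc @^-1` B0) by exact: measurable_preimageT.
  have dot_e j w : dotv (e j) (rvec X w) = delta * X j w.
    by rewrite dotvZl dotv_delta mxE.
  have tiltE w : resc [tuple Z (t j) w - Z h w | j < n] = vector_at X w.
    apply: eq_from_tnth => j; rewrite !tnth_mktuple /Z /linear_process dotvDl dot_e.
    by field; rewrite gt_eqF.
  have shiftE w : resc [tuple Z (t j - h) w | j < n] = tuple_shift u (vector_at X w).
    apply: eq_from_tnth => j; rewrite !tnth_mktuple /Z /linear_process.
    have -> : t j - h = e j by rewrite /t addrAC subrr add0r.
    rewrite dot_e mxE.
    by field; rewrite gt_eqF.
  have := hshift _ delta0 _ hL n t _ (fun j => LD _ _ hL (eL j)) mB.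
  rewrite /Xi_law /tilt_law /path_law unlock => E.
  have {}E : (\int[P]_w (expR (Z h w) * \1_B0 (vector_at X w))%:E =
              \int[P]_w (\1_B0 (tuple_shift u (vector_at X w)))%:E)%E.
    transitivity (P [set w | B0 (tuple_shift u (vector_at X w))]).
      transitivity (P [set w | B0 (resc [tuple Z (t j - h) w | j < n])]).
        rewrite -[RHS]E; apply: eq_integral => w _; congr (_ * _)%:E.
        rewrite !indicE; congr (nat_of_bool _)%:R.
        by apply/idP/idP; rewrite !inE /= tiltE.
      by congr (P _); apply/seteqP; split=> w /=; rewrite shiftE.
    rewrite integral_indic_comp//; apply: measurableT_comp => //.
    exact: measurable_tuple_shift.
  have Zh w : dotv h (rvec X w) = Z h w + kappa h by rewrite /Z /linear_process subrK.
  have me B : measurable B -> measurable_fun setT (fun w => \1_B (vector_at X w) : R).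
    by move=> mB'; apply: measurableT_comp => //; exact: measurable_indic.
  under eq_integral do rewrite Zh addrC expRD -mulrA EFinM.
  rewrite ge0_integralZl_EFin ?expR_ge0//; last first.
    apply/measurable_EFinP; apply: measurable_funM; last exact: me.
    apply: measurableT_comp => //; apply: measurable_funB => //.
    exact: measurable_dot_rvec.
  rewrite E -ge0_integralZl_EFin ?expR_ge0//.
  apply/measurable_EFinP; apply: measurableT_comp; first exact: measurable_indic.
  by apply: measurableT_comp => //; exact: measurable_tuple_shift.
have mshift : measurable_fun setT (fun w => tuple_shift u (vector_at X w)).
  by apply: measurableT_comp => //; exact: measurable_tuple_shift.
rewrite -(ge0_integralZl_EFin P measurableT (fun w _ => f0 _)
  (measurableT_comp mf mshift) (expR_ge0 _)).
apply: (eq_weighted_law _ _ _ _ _ _ key) => //.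
by apply: measurableT_comp => //; exact: measurable_dot_rvec.
Qed.

(** * Maxima over a point process *)

(** Boxes form a pi-system generating the sigma-algebra of tuples. *)
Lemma eq_tuple_law d d' (T : measurableType d) (S : measurableType d')
    (R : realType) (Q : probability T R) n (U1 U2 : T -> n.-tuple S) :
  measurable_fun setT U1 -> measurable_fun setT U2 ->
  (forall B : 'I_n -> set S, (forall i, measurable (B i)) ->
     Q [set w | forall i, B i (tnth (U1 w) i)] =
     Q [set w | forall i, B i (tnth (U2 w) i)]) ->
  forall A, measurable A -> Q (U1 @^-1` A) = Q (U2 @^-1` A).
Proof.
move=> mU1 mU2 boxE A mA.
pose f1 : {mfun T >-> n.-tuple S} := HB.pack U1 (isMeasurableFun.Build _ _ _ _ _ mU1).
pose f2 : {mfun T >-> n.-tuple S} := HB.pack U2 (isMeasurableFun.Build _ _ _ _ _ mU2).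
pose box (B : 'I_n -> set S) := [set x : n.-tuple S | forall i, B i (tnth x i)].
pose G : set (set (n.-tuple S)) := [set C | exists2 B, (forall i, measurable (B i)) & C = box B].
have Gm : G `<=` measurable.
  move=> _ [B mB ->]; rewrite (_ : box B = \bigcap_(i in [set: 'I_n]) ((@tnth n S ^~ i) @^-1` B i)).
    apply: fin_bigcap_measurable => // i _.
    by apply: measurable_preimageT => //; exact: measurable_tnth.
  by apply/seteqP; split=> x xB i; [move=> _|]; apply: xB.
have GT : G setT.
  by exists (fun=> setT) => //; apply/seteqP; split.
apply: (@g_sigma_algebra_measure_unique _ _ _ G Gm (fun=> setT) _ _
  (distribution Q f1) (distribution Q f2)) => //.
- by rewrite bigcup_const//; exists 0%N.
- move=> _ _ [B1 mB1 ->] [B2 mB2 ->]; exists (fun i => B1 i `&` B2 i).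
    by move=> i; exact: measurableI.
  apply/seteqP; split=> x; first by move=> [x1 x2] i; split.
  by move=> xB; split=> i; case: (xB i).
- by move=> _ [B mB ->]; exact: boxE.
- by move=> k; apply: le_lt_trans (probability_le1 _ _) (ltry _).
move: A mA; apply: smallest_sub; first exact: smallest_sigma_algebra.
rewrite -bigcup_seq => _ [i _] [B mB <-].
apply: sub_sigma_algebra; exists (fun j => if j == i then B else setT).
  by move=> j; case: ifP.
apply/seteqP; split=> x; first by move=> [_ Bx] j; case: eqP => [->|].
by move=> /(_ i); rewrite eqxx.
Qed.

(** Up to a limit over N, the event concerns the 2N variables pt i and V i with
    i < N, whose joint law is determined by its values on boxes. *)
Lemma eq_sup_law d (T : measurableType d) (R : realType) (Q : probability T R)
    (pt V V' : nat -> T -> R) (x : R) :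
  (forall i, measurable_fun setT (pt i)) ->
  (forall i, measurable_fun setT (V i)) ->
  (forall i, measurable_fun setT (V' i)) ->
  (forall N (A B : nat -> set R),
     (forall i, measurable (A i)) -> (forall i, measurable (B i)) ->
     Q [set w | forall i, (i < N)%N -> A i (pt i w) /\ B i (V i w)] =
     Q [set w | forall i, (i < N)%N -> A i (pt i w) /\ B i (V' i w)]) ->
  Q [set w | forall i, pt i w + V i w <= x] =
  Q [set w | forall i, pt i w + V' i w <= x].
Proof.
move=> mpt mV mV' boxE.
pose E (W : nat -> T -> R) N := [set w | forall i, (i < N)%N -> pt i w + W i w <= x].
have mE W N : (forall i, measurable_fun setT (W i)) -> measurable (E W N).
  move=> mW; rewrite (_ : E W N =
      \bigcap_(i < N) ((fun w => pt i w + W i w) @^-1` `]-oo, x]%classic)).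
    apply: fin_bigcap_measurable => [|i _]; first exact: finite_II.
    apply: measurable_preimageT => //.
    exact: measurable_funD.
  by apply/seteqP; split=> w wE i iN /=; have := wE i iN; rewrite /= in_itv/=.
have EN N : Q (E V N) = Q (E V' N).
  pose U (W : nat -> T -> R) w : (N + N).-tuple R :=
    [tuple match fintype.split i with inl j => pt j w | inr j => W j w end | i < N + N].
  have mU W : (forall i, measurable_fun setT (W i)) -> measurable_fun setT (U W).
    move=> mW; apply/measurable_fun_tnthP => i.
    rewrite (_ : _ \o _ = match fintype.split i with inl j => pt j | inr j => W j end).
      by case: fintype.split.
    by apply/funext => w /=; rewrite tnth_mktuple; case: fintype.split.
  have UL W w j : tnth (U W w) (lshift N j) = pt j w.
    by rewrite tnth_mktuple; have := unsplitK (inl j : 'I_N + 'I_N); rewrite /= => ->.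
  have UR W w j : tnth (U W w) (rshift N j) = W j w.
    by rewrite tnth_mktuple; have := unsplitK (inr j : 'I_N + 'I_N); rewrite /= => ->.
  pose A : set ((N + N).-tuple R) :=
    [set y | forall j, tnth y (lshift N j) + tnth y (rshift N j) <= x].
  have mA : measurable A.
    rewrite (_ : A = \bigcap_(j in [set: 'I_N])
      ((fun y : (N + N).-tuple R => tnth y (lshift N j) + tnth y (rshift N j)) @^-1` `]-oo, x]%classic)).
      apply: fin_bigcap_measurable => // j _; apply: measurable_preimageT => //.
      by apply: measurable_funD; exact: measurable_tnth.
    apply/seteqP; split=> y yA j; [move=> _|]; first by rewrite /= in_itv/=; apply: yA.
    by have := yA j I; rewrite /= in_itv.
  have EA W : E W N = U W @^-1` A.
    apply/seteqP; split=> w wE => [j|i iN]; first by rewrite UL UR; exact: wE.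
    by have := wE (Ordinal iN); rewrite UL UR.
  rewrite !EA; apply: eq_tuple_law => //; [exact: mU|exact: mU|move=> B mB].
  pose ext (C : 'I_N -> set R) i := if insub i is Some j then C j else setT.
  have extE C (j : 'I_N) : ext C j = C j by rewrite /ext valK.
  have mext C : (forall j, measurable (C j)) -> forall i, measurable (ext C i).
    by move=> mC i; rewrite /ext; case: insub.
  have BE W : [set w | forall i, B i (tnth (U W w) i)] =
      [set w | forall i, (i < N)%N -> ext (B \o lshift N) i (pt i w) /\
                                     ext (B \o @rshift N N) i (W i w)].
    apply/seteqP; split=> w wB => [i iN|i].
      rewrite -[i]/(nat_of_ord (Ordinal iN)) !extE; split.
        by have := wB (lshift N (Ordinal iN)); rewrite UL.
      by have := wB (rshift N (Ordinal iN)); rewrite UR.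
    rewrite -(splitK i); case: (fintype.split i) => j /=.
      by rewrite UL -[B _]/((B \o lshift N) j) -extE; case: (wB j).
    by rewrite UR -[B _]/((B \o @rshift N N) j) -extE; case: (wB j).
  by rewrite !BE; apply: boxE; apply: mext => j; exact: mB.
have limE W : (forall i, measurable_fun setT (W i)) ->
    Q (E W N) @[N --> \oo] --> Q [set w | forall i, pt i w + W i w <= x].
  move=> mW; rewrite [X in Q X](_ : _ = \bigcap_N E W N).
    apply: nonincreasing_cvg_mu => //.
    - by apply: le_lt_trans (probability_le1 _ (mE _ _ mW)) (ltry _).
    - by move=> N; exact: mE.
    - by apply: bigcap_measurable => // N _; exact: mE.
    - move=> M N MN; apply/subsetPset => w wE i iM.
      by apply: wE; exact: leq_trans MN.
  apply/seteqP; split=> w wE => [N _ i _|i]; first exact: wE.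
  exact: (wE i.+1 I i).
have := limE _ mV'; under eq_fun do rewrite -EN; move=> h.
exact: (cvg_unique _ (limE _ mV) h).
Qed.

Section marginals_of_maxima.
Context d (T : measurableType d) (R : realType) (Q : probability T R).
Context (I : Type).
Variables (pt : nat -> {RV Q >-> R}) (Zc : nat -> I -> {RV Q >-> R}).
Hypothesis indep : mutually_independent Q (fun j : option nat =>
  if j is Some i then sigma_of (Zc i) else sigma_of pt).

Lemma zeta_le (t : I) (x : R) (w : T) :
  (zeta pt Zc t w <= x%:E)%E <-> forall i, pt i w + Zc i t w <= x.
Proof.
split=> [le_x i|le_x]; last first.
  by apply: ge_ereal_sup => _ [i _ <-]; rewrite lee_fin.
rewrite -lee_fin; apply: le_trans le_x.
by apply: ereal_sup_ubound; exists i.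
Qed.

Let points_copies_box (t : I) (c : R) (F : set R -> \bar R) N (A B : nat -> set R) :
  (forall i B, measurable B -> Q [set w | B (Zc i t w + c)] = F B) ->
  (forall i, measurable (A i)) -> (forall i, measurable (B i)) ->
  Q [set w | forall i, (i < N)%N -> A i (pt i w) /\ B i (Zc i t w + c)] =
  (Q [set w | forall i, (i < N)%N -> A i (pt i w)] *
   \prod_(i <- iota 0 N) F (B i))%E.
Proof.
move=> FE mA mB.
pose C (j : option nat) := if j is Some i then [set w | B i (Zc i t w + c)]
  else [set w | forall i, (i < N)%N -> A i (pt i w)].
have := indep (s := None :: map Some (iota 0 N)) (A := C).
rewrite !big_cons !big_map => CE.
transitivity (Q (C None `&` \big[setI/setT]_(j <- iota 0 N) C (Some j))).
  congr (Q _); rewrite -bigcap_seq; apply/seteqP; split=> w /=.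
    move=> wAB; split=> [i iN|i /=]; first exact: (wAB i iN).1.
    by rewrite mem_iota add0n => iN; exact: (wAB i iN).2.
  by move=> [wA wB] i iN; split; [exact: wA|apply: wB; rewrite /= mem_iota].
rewrite CE; last 2 first.
- rewrite /= map_inj_uniq ?iota_uniq; last by move=> ? ? [].
  by rewrite andbT; apply/mapP => -[].
- move=> [i _|_].
    apply: sub_sigma_algebra; exists t, [set y | B i (y + c)]; split=> //.
    by apply: (@measurable_preimageT _ _ _ _ (fun y : R => y + c)) => //; exact: measurable_funD.
  pose G := [set D | exists j (B : set R), measurable B /\ D = pt j @^-1` B].
  rewrite (_ : C None = \bigcap_(i < N) (pt i @^-1` A i)); last first.
    by apply/seteqP; split=> w wA i; exact: wA.
  apply: (@fin_bigcap_measurable _ (g_sigma_algebraType G)); first exact: finite_II.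
  by move=> i _; apply: sub_sigma_algebra; exists i, (A i).
by congr (_ * _)%E; apply: eq_bigr => i _; exact: FE.
Qed.

(** The law of the maximum at t depends on the copies only through the law of
    their value at t; so copies whose values at t and t' agree in law up to
    constants have maxima that agree in law up to the same constants. *)
Lemma eq_gumbel_location (t t' : I) (c c' : R) :
  unit_gumbel_marginals Q (zeta pt Zc) ->
  (forall i j B, measurable B ->
     Q [set w | B (Zc i t w + c)] = Q [set w | B (Zc j t' w + c')]) ->
  c = c'.
Proof.
move=> gumbel eqlaw.
have cdfE s b : Q [set w | forall i, pt i w + (Zc i s w + b) <= 0] =
    (expR (- expR b))%:E.
  rewrite -[b in RHS]opprK -(gumbel s (- b)); congr (Q _).
  apply/seteqP; split=> w /=; rewrite zeta_le => le_b i; have := le_b i; lra.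
have mZ s b i : measurable_fun setT (fun w => Zc i s w + b) by exact: measurable_funD.
have := @eq_sup_law _ _ _ Q pt (fun i w => Zc i t w + c)
  (fun i w => Zc i t' w + c') 0 (fun i => measurable_funP (pt i)) (mZ t c) (mZ t' c').
rewrite !cdfE => E; suff /E[/expR_inj/oppr_inj/expR_inj//] :
  forall N (A B : nat -> set R),
     (forall i, measurable (A i)) -> (forall i, measurable (B i)) ->
     Q [set w | forall i, (i < N)%N -> A i (pt i w) /\ B i (Zc i t w + c)] =
     Q [set w | forall i, (i < N)%N -> A i (pt i w) /\ B i (Zc i t' w + c')].
move=> N A B mA mB; pose F B := Q [set w | B (Zc 0%N t' w + c')].
rewrite (@points_copies_box t c F)//; last by move=> i D mD; exact: eqlaw.
rewrite (@points_copies_box t' c' F)// => i D mD.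
by rewrite -(eqlaw i i D mD); exact: eqlaw.
Qed.

End marginals_of_maxima.

(** * The theorem *)

Theorem theorem2p7 (R : realType) (d : nat) (hd : (0 < d)%N)
  (disp : measure_display) (T : measurableType disp) (P : probability T R)
  (X : 'I_d -> {RV P >-> R})
  (hX : forall i, ~ degenerate P (X i))
  (kappa : 'cV[R]_d -> R)
  (mkappa : borel_measurable kappa) (kappa0 : kappa 0 = 0)
  (disp' : measure_display) (T' : measurableType disp') (Q : probability T' R)
  (pt : nat -> {RV Q >-> R}) (Zc : nat -> 'cV[R]_d -> {RV Q >-> R})
  (hrep : max_stable_representation Q P (linear_process X kappa) pt Zc)
  (hgumbel : unit_gumbel_marginals Q (zeta pt Zc))
  (hshift : forall delta : R, 0 < delta ->
     forall h : 'cV[R]_d, lattice delta h ->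
     fdd_eq (lattice delta)
       (Xi_law P (linear_process X kappa) h)
       (path_law P (translate h (linear_process X kappa)))) :
  exists (mu : 'cV[R]_d) (Sigma : 'M[R]_d),
    gaussian_vector P X mu Sigma /\
    forall t : 'cV[R]_d, kappa t = dotv t mu + dotv t (Sigma *m t) / 2.
Proof.
have mX i : measurable_fun setT (X i) by [].
have [mu [Sigma [XG kaxis]]] :=
  gaussian_of_axis_tilts mX (axis_tilt_is_shift kappa0 hshift).
exists mu, Sigma; split=> // t.
have [_ Sigma_ge0 Xlaw] := XG.
have [_ Zlaw indep] := hrep.
pose i0 := Ordinal hd; pose e : 'cV[R]_d := delta_mx i0 0.
have var_gt0 : 0 < dotv e (Sigma *m e).
  rewrite lt_neqAle Sigma_ge0 andbT; apply/eqP => var0.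
  apply: (hX i0); exists (dotv e mu).
  have := Xlaw e [set dotv e mu] (measurable_set1 _).
  rewrite /normal_law -var0 eqxx diracE mem_set// => <-.
  have Xe w : X i0 w = dotv e (rvec X w) by rewrite dotv_delta mxE.
  by congr (P _); apply/seteqP; split=> w /=; rewrite Xe.
(* t' is a point of the first axis at which the variance is the same as at t *)
pose a := Num.sqrt (dotv t (Sigma *m t) / dotv e (Sigma *m e)).
pose t' := a *: e.
have var_t' : dotv t' (Sigma *m t') = dotv t (Sigma *m t).
  rewrite -scalemxAr dotvZl dotvZr mulrA -expr2 sqr_sqrtr ?divr_ge0// ?ltW//.
  by rewrite divfK// gt_eqF.
have kappa_t' : kappa t' = dotv t' mu + dotv t' (Sigma *m t') / 2 := kaxis i0 a.
have copy_law s i B : measurable B ->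
    Q [set w | B (Zc i s w + (kappa s - dotv s mu))] =
    normal_law 0 (dotv s (Sigma *m s)) B.
  move=> mB; rewrite -(normal_law_centered (dotv s mu))// -Xlaw; last first.
    apply: (@measurable_preimageT _ _ _ _ (fun y : R => y - dotv s mu)) => //.
    exact: measurable_funB.
  pose D : set (1.-tuple R) := [set x | B (tnth x ord0 + (kappa s - dotv s mu))].
  have mD : measurable D.
    apply: (@measurable_preimageT _ _ _ _
      (fun x : 1.-tuple R => tnth x ord0 + (kappa s - dotv s mu))) => //.
    by apply: measurable_funD => //; exact: measurable_tnth.
  have := Zlaw i 1%N (fun=> s) D (fun=> I) mD; rewrite /path_law => E.
  transitivity (Q [set w | D [tuple Zc i s w | _ < 1]]).
    by congr (Q _); apply/seteqP; split=> w; rewrite /D/= tnth_mktuple.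
  rewrite [LHS]E; congr (P _); apply/seteqP; split=> w.
    by rewrite /D/= tnth_mktuple /linear_process addrA subrK.
  by rewrite /D/= tnth_mktuple /linear_process addrA subrK.
have : kappa t - dotv t mu = kappa t' - dotv t' mu.
  apply: (eq_gumbel_location indep hgumbel) => i j B mB.
  by apply: etrans (copy_law t i B mB) _; rewrite -var_t'; apply/esym/copy_law.
by rewrite kappa_t' var_t'; lra.
Qed.
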